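(* There exists a graded invertible linear map $\widehat\Psi:T_{\mathcal{A}''}((\mathbb{R}^d))\to T_{\mathcal{A}''}((\mathbb{R}^d))$ such that, for every smooth path $Y=(A,X)$ in $\mathbb{R}^d$, all times $s<t$ in its time interval, and every word $w=w_0i_1w_1\cdots i_kw_k\in\mathcal{W}_{\mathcal{A}}$ (with $w_0,\dots,w_k\in\mathcal{W}_{\mathcal{A}''}$, $i_1,\dots,i_k\in\mathcal{A}'$), $$\big\langle [w_0]i_1[w_1]\cdots i_k[w_k],\ \widehat\Psi(\widehat{\mathrm{Sig}}(Y)_{s,t})\big\rangle=\frac{X_{s,t}^{[w_k]}}{[w_k]!}\int_{s<t_1<\cdots<t_k<t}\ \prod_{j=1}^{k}\frac{X_{s,t_j}^{[w_{j-1}]}}{[w_{j-1}]!}\,\mathrm{d}A^{i_j}_{t_j}.$$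
   Context: $\mathcal{A}$ is an alphabet with $d$ letters, partitioned as $\mathcal{A}=\mathcal{A}'\,\dot\cup\,\mathcal{A}''$ into two nonempty sets; $\mathcal{W}_{\mathcal{B}}$ is the set of words over $\mathcal{B}$ (including the empty word). $\mathbb{R}\langle\mathcal{A}\rangle$ is the free associative algebra on $\mathcal A$, and $[\cdot]$ is the quotient map by the two-sided ideal generated by $\{ij-ji: i,j\in\mathcal{A}''\}$; thus $[w]=[v]$ for words $w,v$ iff they are related by permuting letters inside the $\mathcal{A}''$-blocks, and $[w]=[w_0]i_1[w_1]\cdots i_k[w_k]$ for $w=w_0i_1w_1\cdots i_kw_k$. $T((\mathbb{R}^d))=\prod_{n\ge0}(\mathbb{R}^d)^{\otimes n}$ with basis $e_w=e_{i_1}\otimes\cdots\otimes e_{i_n}$ indexed by words. $T_{\mathcal{A}''}((\mathbb{R}^d))=\prod_{n\ge0}\mathrm{span}\{e_{[w]}:|w|=n\}$, paired by $\langle[w],e_{[v]}\rangle=\mathbf 1_{[w]=[v]}$. The partial symmetrization is the linear map $T((\mathbb{R}^d))\to T_{\mathcal{A}''}((\mathbb{R}^d))$, $\mathbf a\mapsto\widehat{\mathbf a}$, with $\widehat{e_w}=e_{[w]}$, i.e. $\langle[w],\widehat{\mathbf a}\rangle=\sum_{v:[v]=[w]}\langle v,\mathbf a\rangle$. ''Graded'' means preserving the levels $n$, each coordinate of the image being a finite linear combination of coordinates of the same level. For a path $Y$ with components $Y^a$, $a\in\mathcal A$: $A=(Y^a)_{a\in\mathcal{A}'}$, $X=(Y^b)_{b\in\mathcal{A}''}$;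 $\langle i_1\cdots i_n,\mathrm{Sig}(Y)_{s,t}\rangle=\int_{s<t_1<\cdots<t_n<t}\mathrm{d}Y^{i_1}_{t_1}\cdots\mathrm{d}Y^{i_n}_{t_n}$; $\widehat{\mathrm{Sig}}(Y)=\widehat{\mathrm{Sig}(Y)}$. For $v\in\mathcal{W}_{\mathcal{A}''}$ in which letter $i\in\mathcal{A}''$ has multiplicity $\alpha_i$: $X_{s,t}^{[v]}=\prod_{i\in\mathcal{A}''}(X^i_t-X^i_s)^{\alpha_i}$ and $[v]!=\prod_{i\in\mathcal{A}''}\alpha_i!$. *)

(* Defs.v *)
From HB Require Import structures.
From mathcomp Require Import all_boot all_order all_algebra.
From mathcomp Require Import all_classical all_reals all_analysis.
(* The notations of monalg (free algebras) clash with MathComp-Analysis, hence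
   the filtered import and the qualified names. *)
From mathcomp Require Import (canonicals, coercions) monalg.

Set Implicit Arguments.
Unset Strict Implicit.
Unset Printing Implicit Defensive.

Import Order.TTheory GRing.Theory Num.Theory.
Import numFieldNormedType.Exports.

Local Open Scope classical_set_scope.
Local Open Scope ring_scope.

Section WordClasses.
Context (R : realType) (A : finType).

(* R<A>, the monoid algebra of the free monoid on A *)
Definition free_algebra : pzRingType :=
  monalg.malg (monalg.fmonom A) R.

Definition letter (i : A) : free_algebra := monalg.mkmalgU (monalg.fmu i) 1.

Definition monomial (w : seq A) : free_algebra := \prod_(i <- w) letter i.

Definition two_sided_ideal (I : free_algebra -> Prop) : Prop :=
  [/\ I 0, forall x y, I x -> I y -> I (x - y) &
      forall a x b, I x -> I (a * x * b)].

Variable A2 : {set A}.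

(* Membership in the two-sided ideal generated by the i j - j i (i, j in A2) *)
Definition comm_ideal (x : free_algebra) : Prop :=
  forall I, two_sided_ideal I ->
    {in A2 &, forall i j, I (letter i * letter j - letter j * letter i)} ->
    I x.

Definition word_equiv (v w : seq A) : bool :=
  `[< comm_ideal (monomial v - monomial w) >].

Lemma word_equiv_refl : reflexive word_equiv.
Proof. by move=> w; apply/asboolP => I [I0 _ _] _; rewrite subrr. Qed.

Lemma word_equiv_sym : symmetric word_equiv.
Proof.
suff H v w : word_equiv v w -> word_equiv w v.
  by move=> v w; apply/idP/idP; apply: H.
move=> /asboolP vw; apply/asboolP => I II Ig.
have [I0 IB _] := II.
by rewrite -opprB -sub0r; apply: IB => //; exact: vw.
Qed.

Lemma word_equiv_trans : transitive word_equiv.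
Proof.
move=> v u w /asboolP uv /asboolP vw; apply/asboolP => I II Ig.
have [I0 IB _] := II.
have -> : monomial u - monomial w =
          monomial u - monomial v - (0 - (monomial v - monomial w)).
  by rewrite sub0r opprK addrA subrK.
by apply: (IB); [exact: uv | apply: (IB) => //; exact: vw].
Qed.

Definition word_equivR : equiv_rel (seq A) :=
  EquivRel word_equiv word_equiv_refl word_equiv_sym word_equiv_trans.

(* wcls w : word_class is the class [w] in R<A> / comm_ideal. *)
Definition word_class : choiceType := {eq_quot word_equivR}%qT.

Definition wcls (w : seq A) : word_class :=
  (\pi_({eq_quot word_equivR}) w)%qT.

Lemma wcls_eq (v w : seq A) : (wcls v == wcls w) = word_equiv v w.
Proof. exact: eqmodE. Qed.

(* The length of the words in the class c, see level_wcls. *)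
Definition level (c : word_class) : nat :=
  size (repr (c : {eq_quot word_equivR}%qT)).

Lemma wclsK (c : word_class) : wcls (repr (c : {eq_quot word_equivR}%qT)) = c.
Proof. exact: reprK. Qed.

(* Sanity check: two words have the same class exactly when they
   are related by transpositions of adjacent letters of A2. *)
Inductive block_perm (v : seq A) : seq A -> Prop :=
| block_perm_refl : block_perm v v
| block_perm_swap x i j y : i \in A2 -> j \in A2 ->
    block_perm v (x ++ i :: j :: y) -> block_perm v (x ++ j :: i :: y).

Lemma monomialE (w : seq A) :
  monomial w = monalg.mkmalgU (monalg.FMonom w) 1
    :> monalg.malg (monalg.fmonom A) R.
Proof.
rewrite /monomial; elim: w => [|i w IH].
  by rewrite big_nil -monalg.fmoneE.
rewrite big_cons IH /letter [LHS]monalg.fgmulUU mulr1; congr monalg.mkmalgU.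
by rewrite monalg.fmuE; exact: monalg.fmmulE.
Qed.

Lemma block_perm_trans (u v w : seq A) :
  block_perm u v -> block_perm v w -> block_perm u w.
Proof. by move=> uv; elim=> // x i j y iA jA _; exact: block_perm_swap. Qed.

Lemma block_perm_sym (u v : seq A) : block_perm u v -> block_perm v u.
Proof.
elim=> [|x i j y iA jA _]; first exact: block_perm_refl.
by apply: block_perm_trans; apply: block_perm_swap => //; exact: block_perm_refl.
Qed.

Lemma block_perm_size (u v : seq A) : block_perm u v -> size v = size u.
Proof. by elim=> // x i j y _ _ _ <-; rewrite !size_cat. Qed.

Lemma block_perm_cat (x u v y : seq A) :
  block_perm u v -> block_perm (x ++ u ++ y) (x ++ v ++ y).
Proof.
elim=> [|x' i j y' iA jA _]; first exact: block_perm_refl.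
by rewrite -!catA !cat_cons !(catA x); exact: block_perm_swap.
Qed.

Lemma comm_ideal_mmap (x : free_algebra) (f : monalg.fmonom A -> R) :
  (forall u v, block_perm u v -> f (monalg.FMonom u) = f (monalg.FMonom v)) ->
  comm_ideal x -> monalg.mmap idfun f x = 0.
Proof.
pose I (x : free_algebra) := forall f : monalg.fmonom A -> R,
  (forall u v, block_perm u v -> f (monalg.FMonom u) = f (monalg.FMonom v)) ->
  monalg.mmap idfun f x = 0.
move=> fP /(_ I) xI; move: fP; apply: xI => {f x} [|i j iA jA f fP]; last first.
  have E i' j' : letter i' * letter j' = monomial [:: i'; j'].
    by rewrite /monomial !big_cons big_nil mulr1.
  rewrite !E !monomialE raddfB /= !monalg.mmapU !mul1r (fP _ [:: i; j]) ?subrr //.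
  exact: (@block_perm_swap _ [::] j i [::] jA iA (block_perm_refl _)).
split=> [f _|x1 x2 I1 I2 f fP|a x1 b I1 f fP].
- exact: raddf0.
- by rewrite raddfB /= I1 // I2 // subrr.
have L (y z : free_algebra) :
    (forall k c, monalg.mmap idfun f
      ((monalg.mkmalgU k c : free_algebra) * y) = 0) ->
    monalg.mmap idfun f (z * y) = 0.
  move=> H; rewrite (monalg.monalgE z) mulr_suml raddf_sum big1 // => k _.
  exact: H.
have L' (y z : free_algebra) :
    (forall k c, monalg.mmap idfun f
      (y * (monalg.mkmalgU k c : free_algebra)) = 0) ->
    monalg.mmap idfun f (y * z) = 0.
  move=> H; rewrite (monalg.monalgE z) mulr_sumr raddf_sum big1 // => k _.
  exact: H.
apply: L' => l bl; rewrite -mulrA; apply: L => k ak; rewrite mulrA.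
pose g m := f (monalg.mmul (monalg.mmul k m) l).
suff -> : monalg.mmap idfun f ((monalg.mkmalgU k ak : free_algebra) * x1 *
    (monalg.mkmalgU l bl : free_algebra)) = ak * monalg.mmap idfun g x1 * bl.
  rewrite I1 ?mulr0 ?mul0r // => u v uv; rewrite /g.
  have E w : monalg.mmul (monalg.mmul k (monalg.FMonom w)) l =
      monalg.FMonom (k ++ w ++ l).
    by rewrite [LHS]monalg.fmmulE monalg.fmM catA.
  by rewrite !E; apply: fP; exact: block_perm_cat.
rewrite {1}(monalg.monalgE x1) mulr_sumr mulr_suml raddf_sum mulr_sumr mulr_suml.
apply: eq_bigr => m _.
have UU k1 k2 c1 c2 : (monalg.mkmalgU k1 c1 : free_algebra) *
    (monalg.mkmalgU k2 c2 : free_algebra) =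
    monalg.mkmalgU (monalg.mmul k1 k2) (c1 * c2) :> free_algebra.
  exact: monalg.fgmulUU.
by rewrite !UU [LHS]monalg.mmapU /= -!mulrA (mulrC bl).
Qed.

Lemma wcls_block_perm (v w : seq A) : wcls v = wcls w <-> block_perm v w.
Proof.
split.
- move=> /eqP; rewrite wcls_eq => /asboolP vw.
  pose f (m : monalg.fmonom A) : R := `[< block_perm v m >]%:R.
  have /comm_ideal_mmap/(_ vw) : forall u1 u2, block_perm u1 u2 ->
      f (monalg.FMonom u1) = f (monalg.FMonom u2).
    move=> u1 u2 u12; congr (nat_of_bool _)%:R; apply: asbool_equiv_eq.
    split=> vu; first exact: block_perm_trans vu u12.
    exact: block_perm_trans vu (block_perm_sym u12).
  rewrite !monomialE raddfB /= !monalg.mmapU !mul1r /f /=.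
  rewrite asboolT; last exact: block_perm_refl.
  by case: asboolP => // _ /eqP; rewrite subr0 oner_eq0.
- elim=> // x i j y iA jA _ ->; apply/eqP; rewrite wcls_eq; apply/asboolP.
  move=> I [_ _ IM] Ig.
  rewrite /monomial !big_cat !big_cons /= -mulrBr !mulrA -mulrBl.
  by rewrite mulrA; apply: IM; exact: Ig.
Qed.

Lemma level_wcls (w : seq A) : level (wcls w) = size w.
Proof. by apply/esym/block_perm_size/wcls_block_perm/wclsK. Qed.

End WordClasses.

(* T((R^d)) and T_A2((R^d)), as families of coordinates in the bases e_w
   and e_[w]: the pairings <w, a> and <[w], b> are a w and b (wcls R A2 w). *)
Definition tensor_series (R : realType) (A : finType) := seq A -> R^o.

Definition sym_tensor_series (R : realType) (A : finType) (A2 : {set A}) :=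
  word_class R A2 -> R^o.

Definition partial_sym (R : realType) (A : finType) (A2 : {set A})
    (a : tensor_series R A) : sym_tensor_series R A2 :=
  fun c => \sum_(v : (level c).-tuple A | wcls R A2 v == c) a v.

Arguments partial_sym {R A} A2 a c : rename.

Definition graded (R : realType) (A : finType) (A2 : {set A})
    (Psi : sym_tensor_series R A2 -> sym_tensor_series R A2) : Prop :=
  forall c, exists2 s : seq (R * word_class R A2),
    {in s, forall p, level p.2 = level c} &
    forall b, Psi b c = \sum_(p <- s) p.1 * b p.2.

Section Paths.
Context (R : realType) (A : finType).

(* C^infinity on the closed interval [a, b]: f is continuous on [a, b], smooth
   on ]a, b[, and all its derivatives have limits at the endpoints. *)
Definition smooth_on (a b : R) (f : R -> R) : Prop :=
  derivable_oo_LRcontinuous f a b /\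
  forall n, [/\ {in `]a, b[, forall x, derivable (f^`(n)%classic) x 1},
                cvg ((f^`(n)%classic) x @[x --> a^'+]) &
                cvg ((f^`(n)%classic) x @[x --> b^'-])].

Definition smooth_path (a b : R) (Y : A -> R -> R) : Prop :=
  forall i, smooth_on a b (Y i).

Implicit Type Y : A -> R -> R.

(* The integral over s < t_1 < ... < t_n < t of
     F [:: t_1, ..., t_n] dY^{i_1}_{t_1} ... dY^{i_n}_{t_n},
   where dY^i_u = (Y^i)'(u) du. The letters are listed from i_n to i_1, and ts
   collects the integration variables, t_n being the outermost one. *)
Fixpoint simplex_int_rec Y (F : seq R -> R) (s : R) (rw : seq A) (ts : seq R)
    (t : R) : R :=
  if rw is i :: rw' then
    \int[lebesgue_measure]_(u in `]s, t[)
      (simplex_int_rec Y F s rw' (u :: ts) u * (Y i)^`()%classic u)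
  else F ts.

Definition simplex_int Y (w : seq A) (F : seq R -> R) (s t : R) : R :=
  simplex_int_rec Y F s (rev w) [::] t.

Definition signature Y (s t : R) : tensor_series R A :=
  fun w => simplex_int Y w (fun=> 1) s t.

Variable A2 : {set A}.

Definition sym_signature Y (s t : R) : sym_tensor_series R A2 :=
  partial_sym A2 (signature Y s t).

Definition increment_power Y (v : seq A) (s t : R) : R :=
  \prod_(i in A2) (Y i t - Y i s) ^+ count_mem i v.

Definition class_fact (v : seq A) : nat := (\prod_(i in A2) (count_mem i v)`!)%N.

End Paths.

Arguments sym_signature {R A} A2 Y s t c : rename.

(* w_0 i_1 w_1 ... i_k w_k *)
Definition interleave (A : finType) (k : nat) (w : 'I_k.+1 -> seq A)
    (i : 'I_k -> A) : seq A :=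
  w ord0 ++ flatten [seq i j :: w (lift ord0 j) | j <- enum 'I_k].

(* Main.v *)
Require Import Defs.
From HB Require Import structures.
From mathcomp Require Import all_boot all_order all_algebra.
From mathcomp Require Import all_classical all_reals all_analysis.
From mathcomp Require Import ring zify.

(** Why the theorem holds.  Fix s and regard the right-hand side, for the word
    w = w_0 i_1 w_1 ... i_k w_k, as a function G(w) of the upper time t.  With
    H the iterated integral, G(w) = X_{s,t}^[w_k] / [w_k]! * H, and the product
    rule gives a closed linear system
      dG(w) = sum over the letters i of c(i, w) G(w - i) dY^i,
    where w - i is w without its last occurrence of i.
    - If i is a letter of the last block w_k, the derivative of the divided
      power removes i from w_k, with c(i, w) = 1.
    - If i = i_k, differentiating H removes i_k and merges w_{k-1} with w_k, and
      the two divided powers combine to that of the merged block, c(i, w) being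
      the multinomial ratio [w_{k-1} w_k]! / ([w_{k-1}]! [w_k]!).
    - For all other i, c(i, w) = 0.
    The signature solves the simplest such system, d Sig(u i) = Sig(u) dY^i, so
    both sides being continuous and vanishing at s, induction on the length
    yields
      G(w) = sum over u with |u| = |w| of M(w, u) Sig(u),
      M(w, u i) = c(i, w) M(w - i, u)
    (block_intE, from block_int_primitive and the uniqueness of primitives).

    The coefficient M(w, u) depends only on the class [u], since two
    block letters may be removed in either order (transition_block_perm).  The
    sum thus factors through the partial symmetrization, and the matrix M defines
    the graded map of the theorem (block_map, block_map_partial_sym).

    Invertibility: M(w, w) = 1, and M(w, u) <> 0 for [u] <> [w] forces u to
    have strictly fewer pairs formed by a letter of A' and a later letter of A'',
    because passing from w to u only moves A''-letters to the left across
    A'-letters (transition_neq0).  So the matrix is unitriangular on each level.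

    All words are handled reversed, the last letter (the outermost integration)
    at the head, so that the recursions above are structural. *)

Set Implicit Arguments.
Unset Strict Implicit.
Unset Printing Implicit Defensive.

Import Order.TTheory GRing.Theory Num.Theory.
Import numFieldNormedType.Exports.

Local Open Scope ring_scope.

(** * Primitives on a closed interval *)

Section Primitives.
Local Open Scope classical_set_scope.
Local Open Scope ring_scope.
Context (R : realType) (s t : R).
Notation mu := (@lebesgue_measure R).

(** Only continuity is asked at the endpoints: an integral over ]s, x[ vanishes
    for x < s, hence is in general not differentiable at s. *)
Definition is_primitive (f g : R -> R) : Prop :=
  {within `[s, t], continuous f} /\
  {in `]s, t[, forall x, is_derive x (1 : R) f (g x)}.

Lemma within_continuousM (f g : R -> R) :
  {within `[s, t], continuous f} -> {within `[s, t], continuous g} ->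
  {within `[s, t], continuous (fun x => f x * g x)}.
Proof. by move=> cf cg x; apply: continuousM; [exact: cf|exact: cg]. Qed.

Lemma within_continuousD (f g : R -> R) :
  {within `[s, t], continuous f} -> {within `[s, t], continuous g} ->
  {within `[s, t], continuous (fun x => f x + g x)}.
Proof. by move=> cf cg x; apply: continuousD; [exact: cf|exact: cg]. Qed.

Lemma within_continuous_cst (c : R) :
  {within `[s, t], continuous (fun=> c)}.
Proof. by move=> x; exact: cst_continuous. Qed.

Lemma is_primitive_cst c : is_primitive (fun=> c) (fun=> 0).
Proof.
by split=> [|x _]; [exact: within_continuous_cst|exact: is_derive_cst].
Qed.

Lemma is_primitiveD f1 g1 f2 g2 : is_primitive f1 g1 -> is_primitive f2 g2 ->
  is_primitive (fun x => f1 x + f2 x) (fun x => g1 x + g2 x).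
Proof.
move=> [c1 d1] [c2 d2]; split; first exact: within_continuousD.
by move=> x xst; apply: is_deriveD; [exact: d1|exact: d2].
Qed.

Lemma is_primitiveM f1 g1 f2 g2 : is_primitive f1 g1 -> is_primitive f2 g2 ->
  is_primitive (fun x => f1 x * f2 x) (fun x => g1 x * f2 x + f1 x * g2 x).
Proof.
move=> [c1 d1] [c2 d2]; split; first exact: within_continuousM.
move=> x xst; rewrite addrC (mulrC (g1 x)).
by apply: is_deriveM; [exact: d1|exact: d2].
Qed.

Lemma is_primitiveZ c f g : is_primitive f g ->
  is_primitive (fun x => c * f x) (fun x => c * g x).
Proof.
move=> fg; have [C D] := is_primitiveM (is_primitive_cst c) fg; split=> // x xst.
by have := D x xst; rewrite mul0r add0r.
Qed.

Lemma is_primitive_sum (I : Type) (r : seq I) (P : pred I) (f g : I -> R -> R) :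
  (forall i, P i -> is_primitive (f i) (g i)) ->
  is_primitive (fun x => \sum_(i <- r | P i) f i x)
               (fun x => \sum_(i <- r | P i) g i x).
Proof.
move=> fg; elim: r => [|i r IH].
  have -> : (fun x => \sum_(i <- [::] | P i) f i x) = fun=> 0.
    by apply/funext => x; rewrite big_nil.
  have -> : (fun x => \sum_(i <- [::] | P i) g i x) = fun=> 0.
    by apply/funext => x; rewrite big_nil.
  exact: is_primitive_cst.
have -> : (fun x => \sum_(j <- i :: r | P j) f j x) =
    fun x => (if P i then f i x else 0) + \sum_(j <- r | P j) f j x.
  by apply/funext => x; rewrite big_cons; case: ifP; rewrite ?add0r.
have -> : (fun x => \sum_(j <- i :: r | P j) g j x) =
    fun x => (if P i then g i x else 0) + \sum_(j <- r | P j) g j x.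
  by apply/funext => x; rewrite big_cons; case: ifP; rewrite ?add0r.
apply: is_primitiveD IH; case Pi: (P i); [exact: fg|exact: is_primitive_cst].
Qed.

Lemma eq_is_primitive f f' g g' : f =1 f' -> {in `]s, t[, g =1 g'} ->
  is_primitive f g -> is_primitive f' g'.
Proof.
move=> /funext <- gg' [cf df]; split=> // x xst.
by rewrite -gg'//; exact: df.
Qed.

(** The mean value theorem; this is what makes a solution of the differential
    systems below unique. *)
Lemma is_primitive_eq0 f g : s <= t -> is_primitive f g ->
  {in `]s, t[, forall x, g x = 0} -> f s = 0 -> {in `[s, t], forall x, f x = 0}.
Proof.
move=> st [cf df] g0 fs x; rewrite in_itv/= => /andP[sx xt].
have [| |c _] := @MVT_segment R f (fun=> 0) s x sx.
- move=> u; rewrite in_itv/= => /andP[su ux].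
  have ust : u \in `]s, t[ by rewrite in_itv/= su (lt_le_trans ux xt).
  by have := df u ust; rewrite g0.
- apply: continuous_subspaceW cf => u /=; rewrite !in_itv/= => /andP[-> ux].
  exact: le_trans ux xt.
by rewrite mul0r fs subr0.
Qed.

Lemma within_continuous_integrable g : {within `[s, t], continuous g} ->
  mu.-integrable `[s, t] (EFin \o g).
Proof.
by move=> cg; apply: continuous_compact_integrable => //; exact: segment_compact.
Qed.

Lemma Rintegral_oo_cc g x : {within `[s, t], continuous g} ->
  x <= t ->
  \int[mu]_(u in `]s, x[) g u = \int[mu]_(u in `[s, x]) g u.
Proof.
move=> cg xt; have ig := within_continuous_integrable cg.
rewrite Rintegral_itv_bndo_bndc ?Rintegral_itv_obnd_cbnd//.
  apply: integrableS ig => //; apply: subset_itv; rewrite ?bnd_simp//.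
apply: integrableS ig => //; apply: subset_itv; rewrite ?bnd_simp//.
Qed.

Lemma is_primitive_integral g : s < t -> {within `[s, t], continuous g} ->
  is_primitive (fun x => \int[mu]_(u in `]s, x[) g u) g.
Proof.
move=> st cg; have ig := within_continuous_integrable cg; split.
  apply: (@subspace_eq_continuous _ _ _
    (fun x => \int[mu]_(u in `[s, x]) g u)).
    move=> x; rewrite inE/= in_itv/= => /andP[_ xt].
    exact: (esym (Rintegral_oo_cc cg xt)).
  exact: parameterized_integral_continuous (ltW st) ig.
move=> x xst; have := xst; rewrite in_itv/= => /andP[sx xt].
have /continuous_within_itvP[//|cx _ _] := cg.
apply: (@near_eq_is_derive _ _ _ (fun x => \int[mu]_(u in `[s, x]) g u)).
  near=> u; rewrite /= Rintegral_oo_cc//.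
  have : u \in `]s, t[ by near: u; exact: near_in_itvoo.
  by rewrite in_itv/= => /andP[_ /ltW].
have [d e] := @continuous_FTC1 R g (BLeft s) x t xt ig sx (cx x xst).
by apply: DeriveDef => //; rewrite -e derive1E.
Unshelve. all: by end_near. Qed.

End Primitives.

(** * Continuous extension of the derivative of a smooth function *)

Section SmoothC1.
Local Open Scope classical_set_scope.
Local Open Scope ring_scope.
Context (R : realType).

(** The derivative of f is uncontrolled at a and b themselves, where f may be
    anything outside [a, b]; replacing its values there by the one-sided limits
    gives a continuous integrand, to which the fundamental theorem of calculus
    applies up to the boundary. *)
Lemma smooth_on_primitive (a b : R) (f : R -> R) (s t : R) :
  smooth_on a b f -> a <= s -> s < t -> t <= b ->
  exists g, [/\ {within `[s, t], continuous g}, is_primitive s t f g &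
                {in `]s, t[, f^`()%classic =1 g}].
Proof.
move=> [fab sm] as_ st tb.
have ab : a < b by exact: le_lt_trans as_ (lt_le_trans st tb).
have sub x : x \in `]s, t[ -> x \in `]a, b[.
  by rewrite !in_itv/= => /andP[sx xt]; rewrite (le_lt_trans as_ sx) (lt_le_trans xt tb).
have subc : `[s, t] `<=` `[a, b].
  move=> x /=; rewrite !in_itv/= => /andP[sx xt].
  by rewrite (le_trans as_ sx) (le_trans xt tb).
have [df _ _] := sm 0%N.
have [d1f ra lb] := sm 1%N.
pose g x := if x == a then lim (f^`()%classic u @[u --> a^'+]) else
            if x == b then lim (f^`()%classic u @[u --> b^'-]) else f^`()%classic x.
have gE x : x \in `]a, b[ -> f^`()%classic x = g x.
  by rewrite in_itv/= /g => /andP[ax xb]; rewrite gt_eqF// lt_eqF.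
have cg : {within `[a, b], continuous g}.
  apply/continuous_within_itvP => //; split.
  - move=> x xab.
    have cx : {for x, continuous f^`()%classic}.
      exact/differentiable_continuous/derivable1_diffP/d1f.
    rewrite /continuous_at -gE//.
    apply: cvg_trans cx; apply: near_eq_cvg; near=> u.
    by apply: gE; near: u; exact: near_in_itvoo.
  - rewrite {2}/g eqxx; apply: cvg_trans ra; apply: near_eq_cvg; near=> u.
    by apply: gE; rewrite in_itv/=; apply/andP; split; near: u;
      [exact: nbhs_right_gt|exact: nbhs_right_lt].
  - rewrite {2}/g gt_eqF// eqxx; apply: cvg_trans lb; apply: near_eq_cvg; near=> u.
    by apply: gE; rewrite in_itv/=; apply/andP; split; near: u;
      [exact: nbhs_left_gt|exact: nbhs_left_lt].
exists g; split.
- exact: continuous_subspaceW subc cg.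
- split; first exact: continuous_subspaceW subc (derivable_oo_LRcontinuous_within fab).
  move=> x /sub xab; rewrite -gE// derive1E.
  by apply/derivableP; exact: df.
- by move=> x /sub /gE.
Unshelve. all: by end_near. Qed.

End SmoothC1.

(** * Removing exposed letters, and the transition matrix *)

Section Words.
Context (R : realType) (A : finType) (A2 : {set A}).
Implicit Types (p q r u v w : seq A) (i j : A).

(** Words are read backwards: for r = rev (w_0 i_1 ... i_k w_k), lead r is the
    reversed last block w_k and after_lead r is rev (w_0 i_1 ... w_{k-1}). *)
Fixpoint lead r := if r is i :: r' then if i \in A2 then i :: lead r' else [::]
                   else [::].

Fixpoint after_lead r := if r is i :: r' then
  if i \in A2 then after_lead r' else r' else [::].

(** The letters that differentiation can remove: those of the last block, and the
    letter i_k in front of it. *)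
Fixpoint exposed i r := if r is j :: r' then
  (j == i) || (j \in A2) && exposed i r' else false.

Lemma exposed_mem i r : exposed i r -> i \in r.
Proof.
elim: r => //= j r IH; rewrite inE eq_sym => /orP[->//|/andP[_ /IH ->]].
by rewrite orbT.
Qed.

Lemma lead_cat p r : {subset p <= A2} -> lead (p ++ r) = p ++ lead r.
Proof.
elim: p => //= i p IH pA; rewrite pA ?mem_head// IH// => j jp.
by rewrite pA// inE jp orbT.
Qed.

Lemma after_lead_cat p r : {subset p <= A2} -> after_lead (p ++ r) = after_lead r.
Proof.
elim: p => //= i p IH pA; rewrite pA ?mem_head// IH// => j jp.
by rewrite pA// inE jp orbT.
Qed.

Lemma exposed_cat i p r : {subset p <= A2} ->
  exposed i (p ++ r) = (i \in p) || exposed i r.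
Proof.
elim: p => //= j p IH pA; rewrite pA ?mem_head//= IH// => [|k kp].
  by rewrite inE orbA (eq_sym i).
by rewrite pA// inE kp orbT.
Qed.

(** The second case displays the last letter outside A2, which separates the
    outermost integral from the divided power in front of it. *)
Variant lead_spec r : Prop :=
| LeadNil of {subset r <= A2}
| LeadCons p i q of {subset p <= A2} & i \notin A2 & r = p ++ i :: q.

Lemma leadP r : lead_spec r.
Proof.
elim: r => [|i r [rA|p j q pA jA ->]]; first exact: LeadNil.
  case: (boolP (i \in A2)) => iA; last exact: (@LeadCons _ [::] i r).
  by apply: LeadNil => j; rewrite inE => /predU1P[->//|/rA].
case: (boolP (i \in A2)) => iA; last exact: (@LeadCons _ [::] i).
by apply: (@LeadCons _ (i :: p) j q) => // k; rewrite inE => /predU1P[->//|/pA].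
Qed.

Lemma rem_catl i p q : i \in p -> rem i (p ++ q) = rem i p ++ q.
Proof.
elim: p => //= j p IH; rewrite inE eq_sym; case: eqP => //= _ /IH ->//.
Qed.

Lemma rem_catr i p q : i \notin p -> rem i (p ++ q) = p ++ rem i q.
Proof.
by elim: p => //= j p IH; rewrite inE negb_or eq_sym; case: eqP => //= _ /IH ->.
Qed.

(** A letter of A2 never hides another letter; this is why the order of removal
    of two block letters is irrelevant. *)
Lemma exposed_rem i j r : i \in A2 -> i != j -> exposed j (rem i r) = exposed j r.
Proof.
move=> iA /negPf ij; elim: r => //= k r IH; case: eqP => [->|_] /=.
  by rewrite iA ij.
by rewrite IH.
Qed.

Lemma rem_rem i j r : rem i (rem j r) = rem j (rem i r).
Proof.
elim: r => //= k r IH.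
case: (eqVneq k j) => [kj|kj]; case: (eqVneq k i) => [ki|ki] //=;
  rewrite ?(negPf kj) ?(negPf ki) ?kj ?ki ?eqxx ?IH//.
by rewrite -ki kj.
Qed.

Local Notation cfac := (class_fact A2).

(** The coefficient c(i, w) of the differential system.  One operation, rem i,
    serves both kinds of exposed letters: it shortens the last block if i is in
    A2, and otherwise merges the last two blocks. *)
Definition removal_coef i r : R := (exposed i r)%:R *
  (if i \in A2 then 1 else
   (cfac (lead (rem i r)))%:R / ((cfac (lead r))%:R * (cfac (lead (after_lead r)))%:R)).

(** The coefficient of Sig(u) in the block integral of r: the product of the
    removal coefficients met when the letters of u are removed one by one. *)
Fixpoint transition r u : R := if u is i :: u' then
  removal_coef i r * transition (rem i r) u' else (r == [::])%:R.

Lemma cfac_gt0 p : (0 < cfac p)%N.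
Proof. by rewrite prodn_gt0// => i; rewrite fact_gt0. Qed.

Lemma cfac_neq0 p : (cfac p)%:R != 0 :> R.
Proof. by rewrite pnatr_eq0 -lt0n cfac_gt0. Qed.

Lemma cfac_nil : cfac [::] = 1%N.
Proof. by rewrite /class_fact big1. Qed.

Lemma eq_cfac p q : perm_eq p q -> cfac p = cfac q.
Proof. by move=> /permP pq; apply: eq_bigr => i _; rewrite pq. Qed.

Lemma cfac_rem i p : i \in A2 -> i \in p ->
  cfac p = (count_mem i p * cfac (rem i p))%N.
Proof.
move=> iA ip; rewrite /class_fact (bigD1 i)//= [in RHS](bigD1 i)//= mulnA.
congr (_ * _)%N.
  rewrite count_mem_rem eqxx subn1.
  by move: ip; rewrite -has_pred1 has_count; case: count => // n; rewrite factS.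
by apply: eq_bigr => j /andP[_ ji]; rewrite count_mem_rem eq_sym (negPf ji) subn0.
Qed.

Lemma removal_coef_block i r : i \in A2 -> removal_coef i r = (exposed i r)%:R.
Proof. by move=> iA; rewrite /removal_coef iA mulr1. Qed.

Lemma transition_swap r u v i j : i \in A2 -> j \in A2 ->
  transition r (u ++ i :: j :: v) = transition r (u ++ j :: i :: v).
Proof.
move=> iA jA; elim: u r => [|k u IH] r /=; last by rewrite IH.
rewrite !removal_coef_block// (rem_rem i) !mulrA -!natrM !mulnb.
case: (eqVneq i j) => [->//|ij].
by rewrite !exposed_rem// 1?eq_sym// andbC.
Qed.

Lemma transition_block_perm r u v : block_perm A2 u v ->
  transition r (rev u) = transition r (rev v).
Proof.
elim=> // x i j z iA jA _ ->.
by rewrite !rev_cat !rev_cons -!cats1 -!catA /= transition_swap.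
Qed.

Lemma transition_diag r : transition r r = 1.
Proof.
elim: r => [//|i r IH] /=.
rewrite eqxx IH mulr1 /removal_coef /= eqxx mul1r.
by case: (i \in A2) => //; rewrite cfac_nil mul1r divff// cfac_neq0.
Qed.

Definition others r := count (fun i => i \notin A2) r.

(** Since r is read backwards: the pairs consisting of a letter of A2 and a letter outside
    A2 that precedes it in the original word. *)
Fixpoint inversions r := if r is i :: r' then
  ((if i \in A2 then others r' else 0) + inversions r')%N else 0%N.

Lemma others_rem i r : i \in r ->
  others r = ((i \notin A2) + others (rem i r))%N.
Proof. by move=> ir; rewrite /others (permP (perm_to_rem ir)). Qed.

Lemma inversions_rem_block i r : i \in A2 -> exposed i r ->
  inversions r = (others r + inversions (rem i r))%N /\
  block_perm A2 r (i :: rem i r).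
Proof.
move=> iA; elim: r => //= j r IH; case: (eqVneq j i) => [-> _|ji /= /andP[jA ir]].
  by rewrite iA add0n; split=> //; exact: block_perm_refl.
have [IH1 IH2] := IH ir; rewrite jA IH1 add0n.
split.
  by rewrite addnCA addnA (others_rem (exposed_mem ir)) iA; lia.
have := @block_perm_cat _ A2 [:: j] r (i :: rem i r) [::] IH2; rewrite !cats0 => H.
by apply: (@block_perm_swap _ A2 _ [::] j i (rem i r)) => //.
Qed.

Lemma inversions_rem_other p i q : {subset p <= A2} -> i \notin A2 ->
  inversions (p ++ i :: q) = (size p + inversions (p ++ q))%N.
Proof.
move=> + iA; elim: p => /= [_|j p IH pA]; first by rewrite (negPf iA).
rewrite pA ?mem_head// IH => [|k kp]; last by rewrite pA// inE kp orbT.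
by rewrite /others !count_cat /= iA; lia.
Qed.

Lemma inversions_block_perm u v : block_perm A2 u v ->
  others v = others u /\ inversions v = inversions u.
Proof.
elim=> // x i j y iA jA _ [<- <-]; elim: x => [|k x [IHo IHi]] /=.
  by rewrite /others /= iA jA addnCA.
by rewrite IHi; split; [rewrite /others /= -!/(others _) IHo|rewrite IHo].
Qed.

(** Removing a block letter i of r and putting it back at the very end does not
    change the class.  Removing the letter i_k and putting it back at the end
    moves the whole last block in front of it, which destroys as many inversions
    as this block has letters; the class survives only if the block is empty.
    The equality of the numbers of letters outside A2 is what lets the
    induction compare the inversions created by putting i back. *)
Lemma transition_neq0 r u : transition r u != 0 ->
  others u = others r /\ ((inversions u < inversions r)%N \/ block_perm A2 r u).
Proof.
elim: u r => [|i u IH] r /=.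
  case: (r =P [::]) => [->|_]; last by rewrite eqxx.
  by split=> //; right; exact: block_perm_refl.
rewrite mulf_eq0 negb_or => /andP[rc /IH[uo ui]].
have ir : exposed i r.
  by move: rc; rewrite /removal_coef; case: exposed => //; rewrite mul0r eqxx.
split.
  by rewrite (others_rem (exposed_mem ir)) -uo.
have [iA|iA] := boolP (i \in A2).
  have [-> H] := inversions_rem_block iA ir.
  rewrite uo (others_rem (exposed_mem ir)) iA add0n.
  case: ui => [lt|bp]; first by left; rewrite ltn_add2l.
  right; apply: block_perm_trans H _.
  by have := @block_perm_cat _ A2 [:: i] _ _ [::] bp; rewrite !cats0.
rewrite add0n; case: (leadP r) => [rA|p j q pA jA rE].
  by have := rA _ (exposed_mem ir); rewrite (negPf iA).
move: ir uo ui; rewrite rE exposed_cat//=.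
have /negPf ip : i \notin p by apply: contra iA; exact: pA.
rewrite ip (negPf jA) orbF /= => /eqP ji _; subst j.
rewrite rem_catr ?ip//= eqxx => ui; rewrite inversions_rem_other//.
have le : (inversions u <= inversions (p ++ q))%N.
  by case: ui => [/ltnW//|/inversions_block_perm[_ ->]].
case: p {rE pA ip} => [|k p] /= in ui le *; last by left; rewrite addSn ltnS; lia.
case: ui => [lt|bp]; [by left|right].
by have := @block_perm_cat _ A2 [:: i] _ _ [::] bp; rewrite !cats0.
Qed.

End Words.

(** * The linear differential systems *)

Section Functionals.
Local Open Scope classical_set_scope.
Local Open Scope ring_scope.
Context (R : realType) (A : finType) (A2 : {set A}).
Context (s t : R) (Y y : A -> R -> R).
Implicit Types (p q r : seq A) (i j : A).
Hypothesis st : s < t.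
Hypothesis cy : forall i, {within `[s, t], continuous (y i)}.
Hypothesis Yy : forall i, is_primitive s t (Y i) (y i).
Notation mu := (@lebesgue_measure R).
Local Notation cfac := (class_fact A2).

(** X^[p]_{s,x} / [p]!, the factor attached to a block. *)
Definition divided_power p (x : R) : R :=
  increment_power A2 Y p s x / (cfac p)%:R.

(** The same power as a product over the positions of p, which is the form
    suited to inductions on p. *)
Definition increment_monomial p (x : R) : R := \prod_(i <- p) (Y i x - Y i s).

Lemma increment_powerE p x : {subset p <= A2} ->
  increment_power A2 Y p s x = increment_monomial p x.
Proof.
rewrite /increment_power /increment_monomial; elim: p => [_|i p IH pA].
  by rewrite big_nil big1// => i _; rewrite expr0.
have iA : i \in A2 by rewrite pA ?mem_head.
rewrite big_cons -IH => [|j jp]; last by rewrite pA// inE jp orbT.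
rewrite (bigD1 i)//= [in RHS](bigD1 i)//= eqxx add1n exprS -!mulrA.
by do 2 congr (_ * _); apply: eq_bigr => j /andP[_ /negPf]; rewrite eq_sym => ->.
Qed.

Lemma increment_monomial_rem i p x : i \in p ->
  increment_monomial p x = (Y i x - Y i s) * increment_monomial (rem i p) x.
Proof.
by move=> ip; rewrite /increment_monomial (perm_big _ (perm_to_rem ip)) big_cons.
Qed.

Lemma increment_primitive i : is_primitive s t (fun x => Y i x - Y i s) (y i).
Proof.
apply: eq_is_primitive (is_primitiveD (Yy i) (is_primitive_cst s t (- Y i s))) => // x _.
by rewrite addr0.
Qed.

Lemma increment_monomial_primitive p : is_primitive s t (increment_monomial p)
  (fun x => \sum_i (count_mem i p)%:R * increment_monomial (rem i p) x * y i x).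
Proof.
elim: p => [|i p IH].
  apply: eq_is_primitive (is_primitive_cst s t 1) => x.
    by rewrite /increment_monomial big_nil.
  by rewrite big1// => i _; rewrite !mul0r.
apply: eq_is_primitive (is_primitiveM (increment_primitive i) IH) => x.
  by rewrite /increment_monomial big_cons.
move=> _; rewrite mulr_sumr.
transitivity (\sum_j ((i == j)%:R * increment_monomial p x * y j x +
    (Y i x - Y i s) * ((count_mem j p)%:R * increment_monomial (rem j p) x * y j x))).
  rewrite big_split/=; congr (_ + _); rewrite (bigD1 i)//= eqxx mul1r big1.
    by rewrite addr0 mulrC.
  by move=> j /negPf; rewrite eq_sym => ->; rewrite !mul0r.
apply: eq_bigr => j _.
rewrite (_ : count_mem j (i :: p) = ((i == j) + count_mem j p)%N)// natrD rem_cons.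
case: (eqVneq i j) => [<-|ij].
  have [ip|ip] := boolP (i \in p).
    by rewrite (increment_monomial_rem x ip); ring.
  by rewrite (count_memPn ip); ring.
by rewrite /increment_monomial /= big_cons; ring.
Qed.

(** Differentiating X^n / n! gives X^(n-1) / (n-1)!: the multiplicity count i p
    from the product rule is absorbed by the factorial. *)
Lemma divided_power_primitive p : {subset p <= A2} ->
  is_primitive s t (divided_power p)
    (fun x => \sum_i (i \in p)%:R * divided_power (rem i p) x * y i x).
Proof.
move=> pA.
apply: eq_is_primitive
  (is_primitiveZ (cfac p)%:R^-1 (increment_monomial_primitive p)) => x.
  by rewrite /divided_power increment_powerE// mulrC.
move=> _; rewrite mulr_sumr; apply: eq_bigr => i _.
have [ip|ip] := boolP (i \in p); last by rewrite (count_memPn ip) !mul0r mulr0.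
have rA : {subset rem i p <= A2} by move=> j /mem_rem /pA.
have c0 : (count_mem i p)%:R != 0 :> R by rewrite pnatr_eq0 -lt0n -has_count has_pred1.
have := cfac_neq0 R A2 (rem i p).
rewrite /divided_power increment_powerE// (cfac_rem (pA _ ip) ip) natrM => d0.
by rewrite (_ : true%:R = 1)//; field; rewrite c0 d0.
Qed.

Lemma divided_powerM p q x : {subset p <= A2} -> {subset q <= A2} ->
  divided_power p x * divided_power q x =
  (cfac (p ++ q))%:R / ((cfac p)%:R * (cfac q)%:R) * divided_power (p ++ q) x.
Proof.
move=> pA qA; rewrite /divided_power !increment_powerE//; last first.
  by move=> j; rewrite mem_cat => /orP[/pA|/qA].
have := cfac_neq0 R A2 (p ++ q); have := cfac_neq0 R A2 p; have := cfac_neq0 R A2 q.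
rewrite /increment_monomial big_cat /= => h1 h2 h3.
by field; rewrite h1 h2 h3.
Qed.

Lemma eq_divided_power p q x : perm_eq p q -> divided_power p x = divided_power q x.
Proof.
move=> pq; rewrite /divided_power (eq_cfac A2 pq); congr (_ / _).
by apply: eq_bigr => i _; rewrite (permP pq).
Qed.

Lemma divided_power_nil x : divided_power [::] x = 1.
Proof. by rewrite /divided_power cfac_nil divr1 /increment_power big1. Qed.

Lemma divided_power_start p : {subset p <= A2} -> divided_power p s = (p == [::])%:R.
Proof.
case: p => [|i p] pA; first exact: divided_power_nil.
by rewrite /divided_power increment_powerE// /increment_monomial big_cons subrr !mul0r.
Qed.

(** The right-hand side of the theorem for the word rev r; p accumulates the
    part of the current block that has already been read. *)
Fixpoint block_int_acc p r (x : R) : R := if r is i :: r' then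
  if i \in A2 then block_int_acc (i :: p) r' x else
  divided_power p x * \int[mu]_(u in `]s, x[) (block_int_acc [::] r' u * y i u)
  else divided_power p x.

Definition block_int := block_int_acc [::].

(** The signature coordinates, with the derivatives of the path replaced by their
    continuous extensions y. *)
Fixpoint sig_int r (x : R) : R := if r is i :: r' then
  \int[mu]_(u in `]s, x[) (sig_int r' u * y i u) else 1.

Lemma block_int_acc_perm p q r : perm_eq p q -> block_int_acc p r =1 block_int_acc q r.
Proof.
elim: r p q => [|i r IH] p q pq x /=; first exact: eq_divided_power.
case: ifP => _; last by rewrite (eq_divided_power x pq).
by apply: IH; rewrite perm_cons.
Qed.

Lemma block_int_acc_cat p q r : {subset p <= A2} ->
  block_int_acc q (p ++ r) =1 block_int_acc (p ++ q) r.
Proof.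
elim: p q => //= i p IH q pA x; rewrite pA ?mem_head// IH => [|j jp].
  by apply: block_int_acc_perm; rewrite -(cat1s i q) -(cat1s i (p ++ q)) perm_catCA.
by rewrite pA// inE jp orbT.
Qed.

Lemma block_int_block p : {subset p <= A2} -> block_int p =1 divided_power p.
Proof. by move=> pA x; have := block_int_acc_cat [::] [::] pA x; rewrite !cats0. Qed.

Lemma block_int_cat p i q x : {subset p <= A2} -> i \notin A2 ->
  block_int (p ++ i :: q) x =
  divided_power p x * \int[mu]_(u in `]s, x[) (block_int q u * y i u).
Proof.
move=> pA iA; have /= := block_int_acc_cat [::] (i :: q) pA x.
by rewrite (negPf iA) cats0.
Qed.

(** Multiplying by one more block power at the outer time merges this block
    with the last one, up to a multinomial ratio. *)
Lemma block_int_lead p r x : {subset p <= A2} ->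
  divided_power p x * block_int r x =
  (cfac (p ++ lead A2 r))%:R / ((cfac p)%:R * (cfac (lead A2 r))%:R) *
  block_int (p ++ r) x.
Proof.
move=> pA; case: (leadP A2 r) => [rA|q i r' qA iA ->].
  have -> : lead A2 r = r by have := lead_cat [::] rA; rewrite !cats0.
  rewrite !block_int_block ?divided_powerM//.
  by move=> j; rewrite mem_cat => /orP[/pA|/rA].
have pqA : {subset p ++ q <= A2}.
  by move=> j; rewrite mem_cat => /orP[/pA|/qA].
rewrite lead_cat//= (negPf iA) cats0 catA !block_int_cat// mulrA divided_powerM//.
by rewrite -!mulrA.
Qed.

Lemma block_int_swap u v i j : i \in A2 -> j \in A2 ->
  block_int (u ++ i :: j :: v) =1 block_int (u ++ j :: i :: v).
Proof.
move=> iA jA; rewrite /block_int; elim: u [::] => [|k u IH] p x /=.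
  rewrite iA jA; apply: block_int_acc_perm.
  by rewrite -!(cat1s _ (_ :: p)) -!(cat1s _ p) perm_catCA.
case: ifP => _; first exact: IH.
congr (_ * _); apply: eq_Rintegral => z _; by rewrite IH.
Qed.

Lemma block_int_block_perm u v : block_perm A2 u v ->
  block_int (rev u) =1 block_int (rev v).
Proof.
elim=> // x i j z iA jA _ H c; rewrite H.
by rewrite !rev_cat !rev_cons -!cats1 -!catA /= block_int_swap.
Qed.

(** The product rule for divided power times integral.  The induction on the
    length is only there to supply the continuity of the integrand. *)
Lemma block_int_primitive r : is_primitive s t (block_int r)
  (fun x => \sum_i removal_coef R A2 i r * block_int (rem i r) x * y i x).
Proof.
have [n rn] := ubnP (size r); elim: n r rn => // n IH r rn.
case: (leadP A2 r) => [rA|p i q pA iA rE].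
  apply: eq_is_primitive (divided_power_primitive rA) => x.
    by rewrite block_int_block.
  move=> _; apply: eq_bigr => i _; rewrite /removal_coef.
  have -> : exposed A2 i r = (i \in r).
    by have := exposed_cat i [::] rA; rewrite cats0 orbF.
  have [ir|_] := boolP (i \in r); last by rewrite !mul0r.
  rewrite (rA _ ir) mulr1 block_int_block// => j /mem_rem; exact: rA.
have /negPf ip : i \notin p by apply: contra iA; exact: pA.
have cq : {within `[s, t], continuous (fun u => block_int q u * y i u)}.
  apply: within_continuousM => //; apply: (IH q _).1.
  by move: rn; rewrite rE size_cat/=; lia.
have K := is_primitive_integral st cq.
apply: eq_is_primitive (is_primitiveM (divided_power_primitive pA) K) => x.
  by rewrite rE block_int_cat.
move=> _ /=; rewrite rE mulr_suml [LHS]addrC [RHS](bigD1 i)//=; congr (_ + _).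
  rewrite mulrA block_int_lead// /removal_coef exposed_cat//= eqxx orbT (negPf iA).
  rewrite rem_catr ?ip//= eqxx !lead_cat//= (negPf iA) cats0.
  by rewrite after_lead_cat//= (negPf iA) mul1r.
rewrite (bigD1 i)//= ip !mul0r add0r; apply: eq_bigr => j ji.
rewrite /removal_coef exposed_cat//= (negPf iA) orbF (eq_sym i) (negPf ji) orbF.
have [jp|_] := boolP (j \in p); last by rewrite !mul0r.
rewrite pA// mulr1 rem_catl// block_int_cat// => [|k /mem_rem /pA//].
by rewrite -!mulrA (mulrC (y j x)).
Qed.

Lemma block_int_start r : block_int r s = (r == [::])%:R.
Proof.
case: (leadP A2 r) => [rA|p i q pA iA ->].
  by rewrite block_int_block// divided_power_start.
rewrite block_int_cat// set_itv_ge ?bnd_simp ?ltxx// Rintegral_set0 mulr0.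
by case: p {pA}.
Qed.

Lemma sig_int_primitive i r :
  is_primitive s t (sig_int (i :: r)) (fun x => sig_int r x * y i x).
Proof.
suff cr : {within `[s, t], continuous (sig_int r)}.
  by apply: is_primitive_integral => //; exact: within_continuousM.
elim: r => [|j r IH]; first exact: within_continuous_cst.
by apply: (is_primitive_integral st _).1; exact: within_continuousM.
Qed.

Lemma sig_int_start i r : sig_int (i :: r) s = 0.
Proof. by rewrite /= set_itv_ge ?bnd_simp ?ltxx// Rintegral_set0. Qed.

Lemma sum_tuple_cons n (F : seq A -> R) :
  \sum_(u : n.+1.-tuple A) F u = \sum_i \sum_(u : n.-tuple A) F (i :: u).
Proof.
rewrite pair_big/= (reindex (fun p : A * n.-tuple A => [tuple of p.1 :: p.2]))//=.
exists (fun u => (thead u, [tuple of behead u])) => [[i u]|u] _ /=.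
  by congr (_, _); apply: val_inj.
by rewrite [u in RHS]tuple_eta; apply: val_inj.
Qed.

(** Both sides have the same derivative by induction on the length, and for a
    nonempty word both vanish at s. *)
Lemma block_intE r x : x \in `[s, t] ->
  block_int r x = \sum_(u : (size r).-tuple A) transition R A2 r u * sig_int u x.
Proof.
move En : (size r) => n xst; elim: n r En x xst => [|n IH] r rn x xst.
  rewrite (size0nil rn) (big_pred1 [tuple]) => [|u]; last by rewrite (tuple0 u) /= eqxx.
  by rewrite /= mul1r block_int_block// divided_power_nil.
apply/eqP; rewrite -subr_eq0; apply/eqP.
have S : is_primitive s t
    (fun x => \sum_(u : n.+1.-tuple A) transition R A2 r u * sig_int u x)
    (fun x => \sum_i \sum_(u : n.-tuple A)
       transition R A2 r (i :: u) * (sig_int u x * y i x)).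
  pose F x (u : seq A) := transition R A2 r u * sig_int u x.
  have SE := fun x => esym (sum_tuple_cons n (F x)).
  apply: eq_is_primitive SE _ _ => //.
  apply: is_primitive_sum => i _; apply: is_primitive_sum => u _.
  by apply: is_primitiveZ; exact: sig_int_primitive.
have D := is_primitiveD (block_int_primitive r) (is_primitiveZ (-1) S).
rewrite -mulN1r; apply: (is_primitive_eq0 (ltW st) D _ _ xst) => /=.
  move=> z zst; apply/eqP; rewrite mulN1r subr_eq0; apply/eqP.
  apply: eq_bigr => i _ /=; have zst' := subset_itv_oo_cc zst.
  have [ir|ir] := boolP (exposed A2 i r).
    rewrite (IH (rem i r))//; last by rewrite size_rem ?rn// (exposed_mem ir).
    by rewrite mulr_sumr mulr_suml; apply: eq_bigr => u _; rewrite -!mulrA.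
  by rewrite /removal_coef (negPf ir) !mul0r big1// => u _; rewrite !mul0r.
rewrite block_int_start mulN1r big1 => [|u _].
  by rewrite subr0; case: r rn {IH S D}.
by rewrite (tuple_eta u) sig_int_start mulr0.
Qed.

End Functionals.

(** * Iterated integrals over simplices *)

Lemma interleave_recr (A : finType) k (w : 'I_k.+2 -> seq A) (i : 'I_k.+1 -> A) :
  interleave w i =
  interleave (fun j => w (widen_ord (leqnSn k.+1) j))
    (fun j => i (widen_ord (leqnSn k) j))
    ++ i ord_max :: w ord_max.
Proof.
rewrite /interleave enum_ordSr map_rcons flatten_rcons -map_comp -catA.
congr (w _ ++ flatten _ ++ i ord_max :: w _); try exact: val_inj.
by apply: eq_map => j /=; congr (_ :: w _); exact: val_inj.
Qed.

Section IteratedIntegrals.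
Local Open Scope classical_set_scope.
Local Open Scope ring_scope.
Context (R : realType) (A : finType) (A2 : {set A}).
Context (s t : R) (Y y : A -> R -> R).
Hypothesis st : s < t.
Hypothesis cy : forall i, {within `[s, t], continuous (y i)}.
Hypothesis Yy : forall i, is_primitive s t (Y i) (y i).
Hypothesis dY : forall i, {in `]s, t[, (Y i)^`()%classic =1 y i}.
Notation mu := (@lebesgue_measure R).

Lemma itv_sub x u : x \in `[s, t] -> u \in `]s, x[ -> u \in `]s, t[.
Proof.
rewrite !in_itv/= => /andP[_ xt] /andP[-> ux].
exact: lt_le_trans ux xt.
Qed.

Lemma simplex_int_sig r ts x : x \in `[s, t] ->
  simplex_int_rec Y (fun=> 1) s r ts x = sig_int s y r x.
Proof.
elim: r ts x => //= i r IH ts x xst; apply: eq_Rintegral => u.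
rewrite inE/= => /(itv_sub xst) ust.
by rewrite IH ?dY// subset_itv_oo_cc.
Qed.

(** The integrand is a product over all integration variables, but the factor
    g k depends only on the (k+1)-st one: once the k innermost integrals have been
    carried out, the factors of the outer variables ts pull out, and what is left
    is K, the block integral stripped of its last divided power.  The bound n
    may exceed k because the induction strips integrals while the
    integrand keeps all its factors. *)
Lemma simplex_int_block k (w : 'I_k.+1 -> seq A) (i : 'I_k -> A) :
  (forall j, {subset w j <= A2}) -> (forall j, i j \notin A2) ->
  exists K : R -> R,
  (forall x, block_int A2 s Y y (rev (interleave w i)) x =
             divided_power A2 s Y (w ord_max) x * K x) /\
  forall (n : nat) (g : nat -> R -> R) (ts : seq R) x, (k <= n)%N ->
    (forall j : 'I_k, g j =1 divided_power A2 s Y (w (widen_ord (leqnSn k) j))) ->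
    x \in `[s, t] ->
    simplex_int_rec Y (fun l => \prod_(j < n) g j l`_j) s
      (rev [seq i j | j <- enum 'I_k]) ts x =
    (\prod_(k <= j < n) g j ts`_(j - k)) * K x.
Proof.
elim: k w i => [|k IH] w i wA iA.
  have e : enum 'I_0 = [::] by apply: size0nil; rewrite size_enum_ord.
  exists (fun=> 1); split=> [x|n g ts x _ _ _].
    rewrite /interleave e /= cats0 mulr1 block_int_block => [|j].
      rewrite (_ : ord_max = ord0); [exact/eq_divided_power/permPl/perm_rev|exact: val_inj].
    by rewrite mem_rev => /wA.
  rewrite e /= mulr1 big_mkord; apply: eq_bigr => j _; by rewrite subn0.
pose w' (j : 'I_k.+1) := w (widen_ord (leqnSn k.+1) j).
pose i' (j : 'I_k) := i (widen_ord (leqnSn k) j).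
have [K [KE recE]] := IH w' i' (fun=> wA _) (fun=> iA _).
pose h u := block_int A2 s Y y (rev (interleave w' i')) u * y (i ord_max) u.
have ch : {within `[s, t], continuous h}.
  apply: within_continuousM => //.
  by have [] := block_int_primitive A2 st cy Yy (rev (interleave w' i')).
exists (fun x => \int[mu]_(u in `]s, x[) h u); split=> [x|n g ts x kn gE xst].
  rewrite interleave_recr rev_cat rev_cons -cats1 -catA /= block_int_cat//.
    by congr (_ * _); exact/eq_divided_power/permPl/perm_rev.
  by move=> j; rewrite mem_rev => /wA.
rewrite enum_ordSr map_rcons rev_rcons -map_comp /=.
rewrite -RintegralZl//; last first.
  apply: integrableS (within_continuous_integrable ch) => //.
  by move=> u /= /(itv_sub xst); exact: subset_itv_oo_cc.
apply: eq_Rintegral => u; rewrite inE/= => /(itv_sub xst) ust.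
have ust' := subset_itv_oo_cc ust.
rewrite (recE n g (u :: ts) u (ltnW kn) _ ust') => [|j z]; last first.
  by rewrite -(gE (widen_ord (leqnSn k) j)); congr (g _ z).
rewrite big_ltn// subnn /= dY// /h KE.
have -> : \prod_(k.+1 <= j < n) g j (u :: ts)`_(j - k) =
          \prod_(k.+1 <= j < n) g j ts`_(j - k.+1).
  apply: eq_big_nat => j /andP[kj _]; congr (g j _).
  by rewrite -(subnSK kj).
rewrite (gE ord_max).
rewrite -/(w' ord_max). ring.
Qed.

End IteratedIntegrals.

(** * The graded unitriangular map *)

Section Unitriangular.
Context (V : zmodType) (C : Type) (rank : C -> nat) (N : (C -> V) -> C -> V).
Hypothesis N_lower : forall b b' c,
  (forall c', (rank c' < rank c)%N -> b c' = b' c') -> N b c = N b' c.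

(** Solving b + N b = a by forward substitution: at an index of rank n, the
    iteration x := a - N x is stationary after n + 1 steps. *)
Lemma unitriangular_bijective : bijective (fun b c => b c + N b c).
Proof.
pose T b x c : V := b c - N x c.
have iterT b n m c : (rank c < n)%N -> (rank c < m)%N ->
    iter n (T b) (fun=> 0) c = iter m (T b) (fun=> 0) c.
  elim: n m c => // n IH [//|m] c cn cm /=; rewrite /T; congr (_ - _).
  by apply: N_lower => c' c'c; apply: IH; exact: leq_trans c'c _.
pose S b c := iter (rank c).+1 (T b) (fun=> 0) c.
have SK b : (fun c => S b c + N (S b) c) = b.
  apply/funext => c; rewrite {1}/S /= {1}/T (@N_lower _ (S b)) ?subrK// => c' c'c.
  exact: iterT.
have inj x z : (fun c => x c + N x c) = (fun c => z c + N z c) -> x = z.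
  move=> xz; apply/funext => c; have [n cn] := ubnP (rank c).
  elim: n c cn => // n IH c cn; have := congr1 (fun f => f c) xz => /=.
  rewrite (@N_lower x z) => [/addIr//|c' c'c].
  by apply: IH; exact: leq_trans c'c _.
by exists S => [x|b] /=; [apply: inj; rewrite SK|exact: SK].
Qed.

End Unitriangular.

Lemma block_perm_rev (A : finType) (A2 : {set A}) u v :
  block_perm A2 u v -> block_perm A2 (rev u) (rev v).
Proof.
elim=> [|x i j y iA jA _]; first exact: block_perm_refl.
rewrite !rev_cat !rev_cons -!cats1 -!catA /= => uv.
exact: block_perm_swap uv.
Qed.

Section Psi.
Context (R : realType) (A : finType) (A2 : {set A}).
Local Notation rep c := (repr (c : {eq_quot (word_equivR R A2)}%qT)).

Definition level_classes n : seq (word_class R A2) :=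
  undup [seq wcls R A2 v | v : n.-tuple A].

(** The classes of a level are finite in number, and the representative of a class
    is immaterial: on the right by transition_block_perm, on the left
    because the block integrals depend on classes only. *)
Definition block_map (b : sym_tensor_series R A2) : sym_tensor_series R A2 :=
  fun c => \sum_(c' <- level_classes (level c))
             transition R A2 (rev (rep c)) (rev (rep c')) * b c'.

Lemma mem_level_classes n c : (c \in level_classes n) = (level c == n).
Proof.
rewrite mem_undup; apply/mapP/eqP => [[v _ ->]|cn].
  by rewrite level_wcls size_tuple.
have sz : size (rep c) == n by rewrite -cn.
by exists (Tuple sz); rewrite ?mem_enum//= wclsK.
Qed.

Lemma block_map_linear : linear block_map.
Proof.
move=> a u v; apply/funext => c; rewrite /block_map !fctE /=.
rewrite scaler_sumr -big_split/=; apply: eq_bigr => c' _.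
by rewrite mulrDr /GRing.scale/= mulrCA.
Qed.

Lemma block_map_graded : graded block_map.
Proof.
move=> c; exists [seq (transition R A2 (rev (rep c)) (rev (rep c')), c')
                 | c' <- level_classes (level c)].
  by move=> p /mapP[c' + ->]; rewrite mem_level_classes => /eqP.
by move=> b; rewrite big_map.
Qed.

(** The inversions of a representative serve as the rank. *)
Lemma block_map_bijective : bijective block_map.
Proof.
pose N (b : sym_tensor_series R A2) (c : word_class R A2) : R^o :=
  \sum_(c' <- level_classes (level c) | c' != c)
    transition R A2 (rev (rep c)) (rev (rep c')) * b c'.
have -> : block_map = fun b c => b c + N b c.
  apply/funext => b; apply/funext => c; rewrite /block_map (bigD1_seq c) ?undup_uniq//=.
    by rewrite transition_diag mul1r.
  by rewrite mem_level_classes.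
pose rank c := inversions A2 (rev (rep c)).
apply: (@unitriangular_bijective _ _ rank) => b b' c bb'.
apply: eq_bigr => c' c'c.
have [->|/transition_neq0[_ [lt|bp]]] :=
  eqVneq (transition R A2 (rev (rep c)) (rev (rep c'))) 0; first by rewrite !mul0r.
  by rewrite bb'.
case/negP: c'c; apply/eqP; rewrite -[c']wclsK -[c]wclsK.
apply/wcls_block_perm/block_perm_sym.
by rewrite -[repr c]revK -[repr c']revK; exact: block_perm_rev.
Qed.

(** Distributing the symmetrized coordinates over the words of each class turns
    the sum over classes into a sum over all words of the level. *)
Lemma block_map_partial_sym (a : tensor_series R A) c :
  block_map (partial_sym A2 a) c =
  \sum_(u : (level c).-tuple A) transition R A2 (rev (rep c)) u * a (rev u).
Proof.
have rev_inj : injective (fun v : (level c).-tuple A => [tuple of rev v]).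
  by move=> v1 v2 /(congr1 val) /(can_inj revK) /val_inj.
rewrite (reindex_inj rev_inj)/=.
under [RHS]eq_bigr do rewrite revK.
transitivity (\sum_(c' <- level_classes (level c))
    \sum_(v : (level c).-tuple A | wcls R A2 v == c')
      transition R A2 (rev (rep c)) (rev v) * a v).
  apply: eq_big_seq => c'; rewrite mem_level_classes => /eqP <-.
  rewrite /partial_sym mulr_sumr; apply: eq_bigr => v /eqP vc'.
  congr (_ * _); apply: transition_block_perm.
  by apply/(wcls_block_perm R); rewrite wclsK.
rewrite (exchange_big_dep predT)//=; apply: eq_bigr => v _.
under eq_bigl do rewrite eq_sym.
rewrite -big_filter filter_pred1_uniq ?undup_uniq ?big_seq1//.
by rewrite mem_level_classes level_wcls size_tuple.
Qed.

End Psi.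

(** * The coordinates of the signature of a smooth path *)

Theorem corollary1p2 (R : realType) (A : finType) (A1 A2 : {set A})
    (A1_neq0 : A1 != finset.set0) (A2_neq0 : A2 != finset.set0)
    (A1_A2_disjoint : [disjoint A1 & A2]) (A1_A2_cover : A1 :|: A2 = finset.setT) :
  exists Psi : sym_tensor_series R A2 -> sym_tensor_series R A2,
    [/\ linear Psi, bijective Psi, graded Psi &
      forall (a b : R) (Y : A -> R -> R), smooth_path a b Y ->
      forall s t : R, a <= s -> s < t -> t <= b ->
      forall (k : nat) (w : 'I_k.+1 -> seq A) (i : 'I_k -> A),
        (forall j, {subset w j <= A2}) -> (forall j, i j \in A1) ->
        Psi (sym_signature A2 Y s t) (wcls R A2 (interleave w i)) =
        increment_power A2 Y (w ord_max) s t / (class_fact A2 (w ord_max))%:R *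
        simplex_int Y [seq i j | j <- enum 'I_k]
          (fun ts => \prod_(j < k)
             (increment_power A2 Y (w (widen_ord (leqnSn k) j)) s ts`_j /
              (class_fact A2 (w (widen_ord (leqnSn k) j)))%:R)) s t].
Proof.
exists (@block_map R A A2); split.
- exact: block_map_linear.
- exact: block_map_bijective.
- exact: block_map_graded.
move=> a b Y smY s t as_ st tb k w i wA2 iA1.
have iA2 j : i j \notin A2 by rewrite (disjointFr A1_A2_disjoint (iA1 j)).
have /choice[y yP] : forall j, exists g, _ :=
  fun j => smooth_on_primitive (smY j) as_ st tb.
have cy j := let: And3 h _ _ := yP j in h.
have Yy j := let: And3 _ h _ := yP j in h.
have dY j := let: And3 _ _ h := yP j in h.
have tst : t \in `[s, t] by rewrite in_itv/= lexx ltW.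
set c := wcls R A2 (interleave w i).
rewrite /sym_signature block_map_partial_sym.
transitivity (block_int A2 s Y y (rev (interleave w i)) t).
  have bp : block_perm A2 (repr (c : {eq_quot (word_equivR R A2)}%qT)) (interleave w i).
    by apply/(wcls_block_perm R); rewrite wclsK.
  rewrite -(block_int_block_perm s Y y bp t).
  rewrite (block_intE A2 st cy Yy _ tst) size_rev; apply: eq_bigr => u _.
  by rewrite /signature /simplex_int revK (simplex_int_sig dY).
have [K [KE recE]] := simplex_int_block st cy Yy dY wA2 iA2.
pose g n x := divided_power A2 s Y (w (inord n)) x.
have gE (j : 'I_k) : g j =1 divided_power A2 s Y (w (widen_ord (leqnSn k) j)).
  move=> x; rewrite /g; congr (divided_power A2 s Y (w _) x).
  by apply: val_inj; rewrite /= inordK// ltnS ltnW.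
rewrite KE; congr (_ * _); rewrite /simplex_int.
have := recE k g [::] t (leqnn k) gE tst; rewrite big_geq// mul1r => <-.
congr (simplex_int_rec Y _ s _ [::] t); apply/funext => l.
by apply: eq_bigr => j _; rewrite gE.
Qed.
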